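(* Consider the planted dense subgraph problem with $\rho\le1/2$ and $0<q_0<q_1<1$, and let $\nu=\min\{\rho,q_0,1-q_1\}$. Let $k\ge0$ be an integer, $D=2k+1$, and \[ f(Y)=\tau_k\Big(\frac{1}{(q_1-q_0)\rho}\Big(\frac{1}{n-1}\sum_{i=2}^nY_{1i}-q_0\Big)\Big). \] For any $0<r<1$, if $\frac{(q_1-q_0)^2}{q_0}\ge\frac{216}{r^2\rho^2(n-1)}[\log4+3D\log(9/\nu)]$ and $q_1\rho\ge\frac{864}{r^2(n-1)}[\log4+3D\log(9/\nu)]$, then $\mathbb{E}(f(Y)-x)^2\le D^2r^{D-1}$.
   Context: Planted dense subgraph problem: $v\in\{0,1\}^n$ has i.i.d. $\mathrm{Bernoulli}(\rho)$ entries; conditionally on $v$, for each pair $i<j$ independently, $Y_{ij}\sim\mathrm{Bernoulli}(q_0+(q_1-q_0)v_iv_j)$ (with $Y_{1i}$ meaning the entry for the pair $\{1,i\}$); target $x=v_1$. $\tau_k(y)=(2k+1)\binom{2k}{k}\int_0^yt^k(1-t)^k\,dt$, a polynomial of degree $2k+1$. Logarithms are natural. *)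

(* Defs.v *)
From HB Require Import structures.
From mathcomp Require Import all_boot all_order all_algebra.
From mathcomp Require Import reals exp.
Set Implicit Arguments. Unset Strict Implicit. Unset Printing Implicit Defensive.
Import Order.TTheory GRing.Theory Num.Theory.
Local Open Scope ring_scope.

(* Vertices are 'I_n; vertex "1" of the paper is the vertex with value 0.  *)
(* Unordered pairs {i,j} are encoded as ordered pairs (i,j) with i < j.    *)
Definition Pairs (n : nat) := {p : 'I_n * 'I_n | (p.1 < p.2)%N}.

Section PDS.
Variable R : realType.

Definition bern (p : R) (b : bool) : R := if b then p else 1 - p.

Definition pds_weight (n : nat) (rho q0 q1 : R)
    (v : {ffun 'I_n -> bool}) (Y : {ffun Pairs n -> bool}) : R :=
  (\prod_(i : 'I_n) bern rho (v i)) *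
  \prod_(e : Pairs n)
     bern (q0 + (q1 - q0) * ((v (val e).1 && v (val e).2) : bool)%:R) (Y e).

Definition pds_target (n : nat) (v : {ffun 'I_n -> bool}) : R :=
  ([exists i : 'I_n, (nat_of_ord i == 0%N) && v i] : bool)%:R.

Definition row_mean (n : nat) (Y : {ffun Pairs n -> bool}) : R :=
  ((n - 1)%:R)^-1 *
  \sum_(e : Pairs n | nat_of_ord (val e).1 == 0%N) (Y e : bool)%:R.

Definition tau_integrand (k : nat) : {poly R} :=
  ((2 * k + 1)%:R * ('C(2 * k, k))%:R) *: ('X ^+ k * (1 - 'X) ^+ k).

(* tau_k(y) = int_0^y integrand: the formal antiderivative vanishing at 0 *)
Definition tau (k : nat) : {poly R} :=
  \poly_(i < (2 * k + 2)%N)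
     (if i is j.+1 then (tau_integrand k)`_j / (j.+1)%:R else 0).

Definition pds_f (n k : nat) (rho q0 q1 : R) (Y : {ffun Pairs n -> bool}) : R :=
  (tau k).[((q1 - q0) * rho)^-1 * (row_mean Y - q0)].

Definition pds_mse (n k : nat) (rho q0 q1 : R) : R :=
  \sum_(v : {ffun 'I_n -> bool}) \sum_(Y : {ffun Pairs n -> bool})
     pds_weight rho q0 q1 v Y * (pds_f k rho q0 q1 Y - pds_target v) ^+ 2.

End PDS.

(* Main.v *)
Require Import Defs.
From HB Require Import structures.
From mathcomp Require Import all_boot all_order all_algebra.
From mathcomp Require Import reals sequences exp ring lra.
Import Order.TTheory GRing.Theory Num.Theory.
Local Open Scope ring_scope.

(* Given v_1, the sum of the first row is a binomial variable with success
   probability p = q0 + (q1 - q0) rho v_1, and the argument z of tau_k is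
   an affine function of it with mean x = v_1. Since tau_k vanishes to
   order k + 1 at 0 and 1 - tau_k does at 1, (tau_k(z) - x)^2 is at most
   D^2 (4 t (1 + t))^(2k) t^2 with t = |z - x|. Instead of splitting according
   to the size of t, dominate this by a constant multiple of
   D^2 r^(2k) 4^(-k) exp(8 D t / r), and bound the exponential moment of t; the
   two signal-to-noise hypotheses make it at most 2 * 2^D. *)

(** * The polynomial [tau]: endpoint values, symmetry, growth *)

Lemma deriv_inj0 (R : realFieldType) (p q : {poly R}) :
  p^`() = q^`() -> p.[0] = q.[0] -> p = q.
Proof.
rewrite !horner_coef0 => dpq pq0; apply/polyP => -[//|i].
have := congr1 (fun s : {poly R} => s`_i) dpq; rewrite !coef_deriv.
by move/eqP; rewrite eqrMn2r // => /eqP.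
Qed.

(** Beta integral by formal integration by parts: each step trades a factor [1 - 'X] for a factor
    ['X], so the induction on [b] keeps [a] general. *)
Lemma beta_poly (R : realFieldType) (b a : nat) : exists P : {poly R},
  [/\ P^`() = 'X ^+ a * (1 - 'X) ^+ b, P.[0] = 0 &
      P.[1] = (a`! * b`!)%:R / ((a + b).+1)`!%:R].
Proof.
elim: b a => [|b IHb] a.
  exists ((a.+1%:R)^-1 *: 'X ^+ a.+1); split.
  - rewrite derivZ derivXn expr0 mulr1 -scaler_nat scalerA mulVf ?scale1r //.
    by rewrite pnatr_eq0.
  - by rewrite hornerZ hornerXn expr0n mulr0.
  - rewrite hornerZ hornerXn expr1n mulr1 addn0 muln1 factS natrM invfM.
    by rewrite mulrCA divff ?mulr1 // pnatr_eq0 -lt0n fact_gt0.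
have [P [dP P0 P1]] := IHb a.+1.
have a_neq0 : a.+1%:R != 0 :> R by rewrite pnatr_eq0.
exists ((a.+1%:R)^-1 *: ('X ^+ a.+1 * (1 - 'X) ^+ b.+1 + b.+1%:R *: P)); split.
- rewrite derivZ derivD derivM derivXn derivZ dP deriv_exp derivB derivX derivC /=.
  rewrite -['X^a *+ _]scaler_nat -[(_ * _ *+ _)]scaler_nat.
  rewrite sub0r mulN1r scalerN mulrN -scalerAr addrNK -scalerAl scalerA mulVf //.
  by rewrite scale1r.
- by rewrite !hornerE P0 expr0n /= !(mul0r, mulr0, addr0).
- rewrite !hornerE P1 subrr expr0n /= mulr0 add0r addSnnS.
  rewrite !factS !natrM; field.
  by rewrite !nat1r -natrD !nat1r !pnatr_eq0 -!lt0n fact_gt0.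
Qed.

Lemma tau_integrandE (R : realType) k : tau_integrand R k =
  ((2 * k + 1)%:R * ('C(2 * k, k))%:R) *:
    \sum_(i < k.+1) ((-1) ^+ i * 'C(k, i)%:R) *: 'X^(k + i).
Proof.
rewrite /tau_integrand exprBn mulr_sumr; congr (_ *: _).
apply: eq_bigr => i _; rewrite expr1n mulr1 exprD.
rewrite -mulrnAr -mulr_natr mulrCA -mul_polyC rmorphM rmorphXn rmorphN1 rmorph_nat.
by ring.
Qed.

Lemma deriv_tau (R : realType) k : (tau R k)^`() = tau_integrand R k.
Proof.
apply/polyP => i; rewrite coef_deriv coef_poly addn2 ltnS.
case: ltnP => [_|ki]; first by rewrite -[_ *+ i.+1]mulr_natr divfK ?pnatr_eq0.
(* The truncation in [tau] loses nothing: the integrand has degree at most 2k, and here i > 2k. *)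
rewrite mul0rn tau_integrandE coefZ coef_sum big1 ?mulr0 // => j _.
rewrite coefZ coefXn gtn_eqF ?mulr0 //; apply: leq_trans ki.
by rewrite ltnS mul2n -addnn leq_add2l -ltnS.
Qed.

Lemma tau_at0 (R : realType) k : (tau R k).[0] = 0.
Proof. by rewrite horner_coef0 coef_poly addn2. Qed.

(** The prefactor of the integrand is the inverse of the Beta integral k! k! / (2k+1)!. *)
Lemma tau_at1 (R : realType) k : (tau R k).[1] = 1.
Proof.
have [P [dP P0 P1]] := beta_poly R k k.
have -> : tau R k = ((2 * k + 1)%:R * ('C(2 * k, k))%:R) *: P.
  apply: deriv_inj0; first by rewrite deriv_tau derivZ dP.
  by rewrite tau_at0 hornerZ P0 mulr0.
rewrite hornerZ P1 addnn -mul2n factS addn1 mulrA -!natrM.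
have := bin_fact (leq_pmull k (isT : (0 < 2)%N)).
rewrite mul2n -addnn addnK => <-.
by rewrite -mulnA divff // pnatr_eq0 -!lt0n !muln_gt0 !fact_gt0 bin_gt0 leq_addr.
Qed.

(** The integrand is invariant under t -> 1 - t, so both sides have the same derivative; they agree
    at 0 because [tau] is 1 at 1. *)
Lemma tau_symmetry (R : realType) k (y : R) : (tau R k).[1 - y] = 1 - (tau R k).[y].
Proof.
have E : tau R k \Po (1 - 'X) = 1 - tau R k.
  apply: deriv_inj0; last by rewrite horner_comp !hornerE subr0 tau_at0 tau_at1 subr0.
  rewrite deriv_comp !derivB derivX derivC !sub0r deriv_tau mulrN1.
  rewrite /tau_integrand comp_polyZ rmorphM /= !rmorphXn /= comp_polyX.
  by rewrite rmorphB /= rmorph1 comp_polyX subKr [X in _ *: X]mulrC.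
by have := congr1 (horner^~ y) E; rewrite horner_comp !hornerE.
Qed.

Lemma central_bin_le k : ('C(2 * k, k) <= 4 ^ k)%N.
Proof.
rewrite -[4%N]/((1 + 1) ^ 2)%N -expnM expnDn.
have kk : (k < (2 * k).+1)%N by rewrite ltnS leq_pmull.
rewrite (bigD1 (Ordinal kk)) //= !exp1n !muln1; exact: leq_addr.
Qed.

(** Integrate the expanded integrand term by term. The denominators k+i+1 are at least 1, and the
    absolute values of the remaining terms sum back to a binomial power. *)
Lemma tau_near0 (R : realType) k (y : R) :
  `|(tau R k).[y]| <= (2 * k + 1)%:R * 4 ^+ k * `|y| ^+ k.+1 * (1 + `|y|) ^+ k.
Proof.
have E : tau R k = ((2 * k + 1)%:R * ('C(2 * k, k))%:R) *:
    \sum_(i < k.+1) ((-1) ^+ i * 'C(k, i)%:R / (k + i).+1%:R) *: 'X^((k + i).+1).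
  apply: deriv_inj0.
    rewrite deriv_tau derivZ tau_integrandE; congr (_ *: _); rewrite raddf_sum.
    apply: eq_bigr => i _; rewrite /= derivZ derivXn -scaler_nat scalerA.
    by rewrite divfK ?pnatr_eq0.
  rewrite tau_at0 hornerZ horner_sum big1 ?mulr0 // => i _.
  by rewrite hornerZ hornerXn expr0n mulr0.
rewrite E hornerZ normrM ger0_norm ?mulr_ge0 ?ler0n // -!mulrA.
rewrite ler_wpM2l ?ler0n //; apply: ler_pM; rewrite ?ler0n ?normr_ge0 //.
  by rewrite -natrX ler_nat central_bin_le.
rewrite horner_sum (le_trans (ler_norm_sum _ _ _)) // addrC exprD1n mulr_sumr.
apply: ler_sum => i _.
rewrite hornerZ hornerXn -!mulrA normrM normrX normrN1 expr1n mul1r !normrM.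
rewrite normrX normfV !normr_nat -addSn exprD mulrnAr -[X in _ <= X]mulr_natl.
by rewrite ?mulr1 ler_wpM2l // ler_piMl ?mulr_ge0 ?exprn_ge0 // invf_le1 ?ler1n ?ltr0n.
Qed.

Lemma tau_near (R : realType) k (x : bool) (z : R) :
  `|(tau R k).[z] - x%:R| <=
    (2 * k + 1)%:R * 4 ^+ k * `|z - x%:R| ^+ k.+1 * (1 + `|z - x%:R|) ^+ k.
Proof.
case: x; last by rewrite !subr0; apply: tau_near0.
rewrite distrC -tau_symmetry [`|z - _|]distrC; exact: tau_near0.
Qed.

(** * Exponential bounds for a Bernoulli variable and for the error of [tau] *)

Lemma bernoulli_exp_moment (R : realType) (p t : R) : 0 <= p -> t <= 1 / 2 ->
  \sum_b bern p b * expR (t * (b%:R - p)) <= expR (2 * p * t ^+ 2).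
Proof.
move=> p0 t12; rewrite big_bool /bern /= sub0r mulrBr mulr1 mulrN expRD.
set E := expR (- _); have E0 : 0 < E by apply: expR_gt0.
(* From (1 - t) e^t <= 1, since (1 - t)(1 + t + 2t^2) = 1 + t^2 (1 - 2t) >= 1 when t <= 1/2,
   negative t included. *)
have et : expR t <= 1 + t + 2 * t ^+ 2.
  have := expR_ge1Dx (- t); rewrite expRN => h.
  have e0 := expR_gt0 t.
  have : (1 - t) * expR t <= 1 by rewrite -ler_pdivlMr // mul1r.
  have e1 := expR_ge1Dx t.
  nra.
have -> : 2 * p * t ^+ 2 = p * (t + 2 * t ^+ 2) + - (t * p) by ring.
rewrite expRD -/E.
have := expR_ge1Dx (p * (t + 2 * t ^+ 2)).
set F := expR (p * _) => hF.
have -> : p * (expR t * E) + (1 - p) * E = (1 + p * (expR t - 1)) * E by ring.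
rewrite ler_pM2r //; nra.
Qed.

(* With t = r u, both factors 4 t (1 + t) / r and t are absorbed by powers of e^(8u). *)
Lemma tau_error_le_exp (R : realType) k (x : bool) (z r : R) : 0 < r -> r <= 1 ->
  ((tau R k).[z] - x%:R) ^+ 2 <=
    (2 * k + 1)%:R ^+ 2 * r ^+ (2 * k) / (4 ^+ k * 16) *
    expR ((8 * (2 * k + 1)%:R / r) * `|z - x%:R|).
Proof.
move=> r0 r1; set D : R := (2 * k + 1)%:R; set t := `|z - x%:R|.
have t0 : 0 <= t by apply: normr_ge0.
pose u := t / r.
have u0 : 0 <= u by rewrite divr_ge0 // ltW.
have tE : t = r * u by rewrite mulrC divfK ?gt_eqF.
set e := expR (4 * u).
have eE : 1 + 4 * u <= e by apply: expR_ge1Dx.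
have e2 : (1 + 4 * u) ^+ 2 <= e ^+ 2 by rewrite lerXn2r // nnegrE; lra.
(* As r <= 1, it suffices that 4u(1 + u) <= (1 + 4u)^2 / 2, and u^2 <= (1 + 4u)^2 / 16 for the next
   bound. *)
have h1 : 4 * t * (1 + t) <= r * e ^+ 2 / 2 by rewrite tE; nra.
have h2 : t ^+ 2 <= e ^+ 2 / 16 by rewrite tE; nra.
have -> : expR (8 * D / r * t) = (e ^+ 2) ^+ (2 * k + 1).
  by rewrite -exprM -expRM_natl natrM -/D; congr expR; rewrite /u; field; rewrite gt_eqF.
rewrite -real_normK ?num_real //; apply: (@le_trans _ _ ((D * (4 * t * (1 + t)) ^+ k * t) ^+ 2)).
  have := tau_near R k x z; rewrite -/D -/t => h.
  rewrite lerXn2r ?nnegrE ?normr_ge0 //.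
    by rewrite !mulr_ge0 ?exprn_ge0 ?ler0n // !mulr_ge0 ?addr_ge0.
  by apply: le_trans h _; rewrite le_eqVlt; apply/orP; left; apply/eqP; rewrite !exprMn exprS; ring.
have -> : (D * (4 * t * (1 + t)) ^+ k * t) ^+ 2 = D ^+ 2 * ((4 * t * (1 + t)) ^+ (2 * k) * t ^+ 2).
  by rewrite !exprMn -!exprM [(2 * k)%N]mulnC; ring.
have -> : D ^+ 2 * r ^+ (2 * k) / (4 ^+ k * 16) * (e ^+ 2) ^+ (2 * k + 1) =
   D ^+ 2 * ((r * e ^+ 2 / 2) ^+ (2 * k) * (e ^+ 2 / 16)).
  have -> : 4 ^+ k = 2 ^+ (2 * k) :> R by rewrite exprM; congr (_ ^+ _); ring.
  rewrite !exprMn exprVn exprD expr1; field.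
  by rewrite expf_neq0 // pnatr_eq0.
rewrite ler_wpM2l ?exprn_ge0 ?ler0n //; apply: ler_pM => //.
- by rewrite exprn_ge0 // !mulr_ge0 ?addr_ge0.
- by rewrite exprn_ge0.
- by rewrite lerXn2r // nnegrE; nra.
Qed.

(** * Law of the first row and its exponential moment *)

Lemma prod_first_row (R : realType) (n : nat) (F : 'I_n.+2 -> R) :
  \prod_(e : Pairs n.+2 | nat_of_ord (val e).1 == 0%N) F (val e).2 =
  \prod_(j | j != ord0) F j.
Proof.
have p01 : ((ord0 : 'I_n.+2, ord_max : 'I_n.+2).1 < (ord0 : 'I_n.+2, ord_max : 'I_n.+2).2)%N by [].
(* Default for [insubd], reached only at j = 0, which the index range excludes. *)
pose e0 : Pairs n.+2 := exist _ (ord0, ord_max) p01.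
rewrite [RHS](reindex_onto (fun e : Pairs n.+2 => (val e).2)
  (fun j => insubd e0 (ord0, j))) /=; last first.
  by move=> j j0; rewrite val_insubd /= lt0n j0.
apply: eq_bigl => e.
have e12 := valP e; rewrite /= in e12.
have -> : (val e).2 != ord0 by rewrite -lt0n (leq_ltn_trans _ e12).
rewrite /= -val_eqE /= val_insubd /= (leq_ltn_trans (leq0n _) e12).
by rewrite [in RHS](surjective_pairing (val e)) xpair_eqE eqxx andbT eq_sym.
Qed.

(** Entries outside the first row sum out to 1. Once the label of [ord0] is fixed, each row entry
    involves its own independent label, and averaging over that label replaces it by [rho] in the
    success probability. *)
Lemma pds_weight_sum_row (R : realType) (n : nat) (rho q0 q1 : R) (h : bool -> bool -> R) :
  \sum_(v : {ffun 'I_n.+2 -> bool}) \sum_(Y : {ffun Pairs n.+2 -> bool})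
    pds_weight rho q0 q1 v Y *
    \prod_(e : Pairs n.+2 | nat_of_ord (val e).1 == 0%N) h (v ord0) (Y e) =
  \sum_x bern rho x *
    (\sum_y bern (q0 + (q1 - q0) * rho * x%:R) y * h x y) ^+ n.+1.
Proof.
pose H (a b : bool) := \sum_y bern (q0 + (q1 - q0) * (a && b)%:R) y * h a y.
have sumY (v : {ffun 'I_n.+2 -> bool}) :
    \sum_(Y : {ffun Pairs n.+2 -> bool}) pds_weight rho q0 q1 v Y *
      \prod_(e : Pairs n.+2 | nat_of_ord (val e).1 == 0%N) h (v ord0) (Y e) =
    (\prod_i bern rho (v i)) * \prod_(j | j != ord0) H (v ord0) (v j).
  (* The row factor is extended by 1 to all pairs, so that sum and product can be exchanged. *)
  pose G (e : Pairs n.+2) y :=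
    bern (q0 + (q1 - q0) * (v (val e).1 && v (val e).2)%:R) y *
    (if nat_of_ord (val e).1 == 0%N then h (v ord0) y else 1).
  transitivity ((\prod_i bern rho (v i)) *
      \sum_(Y : {ffun Pairs n.+2 -> bool}) \prod_e G e (Y e)).
    rewrite mulr_sumr; apply: eq_bigr => Y _; rewrite /pds_weight -mulrA.
    by rewrite big_split -big_mkcond.
  congr (_ * _); rewrite -bigA_distr_bigA /=.
  rewrite -prod_first_row [RHS]big_mkcond; apply: eq_bigr => e _; rewrite /G.
  case: eqP => [e0|_]; last first.
    by rewrite big_bool /= /bern !mulr1 addrC subrK.
  by have -> : (val e).1 = ord0 by apply: val_inj.
under eq_bigr do rewrite sumY.
rewrite (partition_big (fun v : {ffun 'I_n.+2 -> bool} => v ord0) xpredT) //=.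
apply: eq_bigr => x _.
(* Fixing the label of [ord0] is a coordinatewise constraint, so the sum over [v] also
   factorises. *)
pose Q (i : 'I_n.+2) (b : bool) := (i == ord0) ==> (b == x).
pose F (i : 'I_n.+2) (b : bool) := bern rho b * (if i == ord0 then 1 else H x b).
transitivity (\sum_(v in family Q) \prod_i F i (v i)).
  apply: eq_big => [v|v /eqP v0].
    apply/idP/familyP => [/eqP vx i|/(_ ord0)]; last exact.
    by apply/implyP => /eqP ->; apply/eqP.
  rewrite big_split /= v0; congr (_ * _); rewrite big_mkcond /=.
  by apply: eq_bigr => i _; case: eqP.
rewrite -(bigA_distr_big_dep Q F) (bigD1 ord0) //=; congr (_ * _).
  by rewrite (big_pred1 x) // /F eqxx mulr1.
rewrite (eq_bigr (fun=> \sum_y bern (q0 + (q1 - q0) * rho * x%:R) y * h x y)).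
  rewrite prodr_const; congr (_ ^+ _).
  by rewrite cardC1 card_ord.
move=> i /negbTE i0; rewrite /Q i0 /= /F i0 /H !big_bool /=.
by rewrite /bern; case: (x); rewrite /=; ring.
Qed.

Lemma first_row_exp_moment (R : realType) (n : nat) (rho q0 q1 t : R) :
  0 <= rho -> rho <= 1 -> 0 <= q0 -> q0 <= q1 -> q1 <= 1 -> t <= 1 / 2 ->
  \sum_(v : {ffun 'I_n.+2 -> bool}) \sum_(Y : {ffun Pairs n.+2 -> bool})
    pds_weight rho q0 q1 v Y *
    expR (t * (\sum_(e : Pairs n.+2 | nat_of_ord (val e).1 == 0%N) (Y e)%:R -
               n.+1%:R * (q0 + (q1 - q0) * rho * (v ord0)%:R))) <=
  expR (2 * n.+1%:R * (q0 + (q1 - q0) * rho) * t ^+ 2).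
Proof.
move=> rho0 rho1 q00 q01 q11 t12.
pose p (x : bool) := q0 + (q1 - q0) * rho * x%:R.
have a0 : 0 <= (q1 - q0) * rho by rewrite mulr_ge0 // subr_ge0.
pose h (x y : bool) := expR (t * (y%:R - p x)).
have hE (v : {ffun 'I_n.+2 -> bool}) (Y : {ffun Pairs n.+2 -> bool}) :
    expR (t * (\sum_(e : Pairs n.+2 | nat_of_ord (val e).1 == 0%N) (Y e)%:R -
               n.+1%:R * p (v ord0))) =
    \prod_(e : Pairs n.+2 | nat_of_ord (val e).1 == 0%N) h (v ord0) (Y e).
  rewrite -expR_sum -mulr_sumr sumrB; congr (expR (t * (_ - _))).
  (* Counts the n+1 row entries: the product identity for a constant exponential becomes one for
     sums by injectivity of [expR]. *)
  have := prod_first_row R n (fun=> expR (p (v ord0))).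
  rewrite -!expR_sum => /expR_inj ->.
  by rewrite sumr_const cardC1 card_ord mulr_natl.
under eq_bigr do under eq_bigr do rewrite hE.
rewrite pds_weight_sum_row.
(* The bound is written as a mixture with the same weights, to compare separately for each x. *)
have -> : expR (2 * n.+1%:R * (q0 + (q1 - q0) * rho) * t ^+ 2) =
    \sum_x bern rho x * expR (2 * (q0 + (q1 - q0) * rho) * t ^+ 2) ^+ n.+1.
  rewrite -mulr_suml big_bool /bern /= addrC subrK mul1r -expRM_natl.
  by congr expR; ring.
apply: ler_sum => x _; apply: ler_wpM2l.
  by case: x; rewrite /bern ?subr_ge0.
have p0 : 0 <= p x by rewrite addr_ge0 // mulr_ge0.
rewrite lerXn2r ?nnegrE ?expR_ge0 //; last first.
  apply: le_trans (bernoulli_exp_moment R (p x) t p0 t12) _.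
  rewrite ler_expR ler_wpM2r ?sqr_ge0 // ler_wpM2l // lerD2l.
  by case: (x); rewrite ?mulr1 ?mulr0.
have p1 : p x <= 1 by rewrite /p; case: (x); rewrite ?mulr1 ?mulr0; nra.
by apply: sumr_ge0 => y _; rewrite mulr_ge0 ?expR_ge0 // /bern; case: y; rewrite ?subr_ge0.
Qed.

Lemma pds_weight_ge0 (R : realType) (n : nat) (rho q0 q1 : R)
    (v : {ffun 'I_n -> bool}) (Y : {ffun Pairs n -> bool}) :
  0 <= rho -> rho <= 1 -> 0 <= q0 -> q0 <= q1 -> q1 <= 1 ->
  0 <= pds_weight rho q0 q1 v Y.
Proof.
move=> rho0 rho1 q00 q01 q11; rewrite mulr_ge0 //; apply: prodr_ge0.
  by move=> i _; rewrite /bern; case: (v i); lra.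
by move=> e _; rewrite /bern; case: (Y e); case: andb; rewrite /= ?mulr1 ?mulr0; lra.
Qed.

(** * Numerical consequences of the signal-to-noise hypotheses *)

Lemma ln18_ge (R : realType) : 17 / 18 <= ln 18 :> R.
Proof.
have : ln (1 + (18^-1 - 1)) <= 18^-1 - 1 :> R by apply: le_ln1Dx; lra.
by rewrite addrC subrK lnV ?posrE //; lra.
Qed.

(** The bound t <= 1/2 permits the Bernoulli moment estimate for both t and -t; the second bound
    keeps the resulting exponent at most D/2. *)
Lemma snr_bounds (R : realType) (D m rho q0 q1 r L : R) :
  1 <= D -> 0 < m -> 0 < rho -> rho <= 1 -> 0 < q0 -> q0 < q1 -> 0 < r -> r <= 1 ->
  17 / 6 * D <= L ->
  216 / (r ^+ 2 * rho ^+ 2 * m) * L <= (q1 - q0) ^+ 2 / q0 ->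
  864 / (r ^+ 2 * m) * L <= q1 * rho ->
  let a := (q1 - q0) * rho in
  let t := 8 * D / (r * m * a) in
  0 <= t <= 1 / 2 /\ 2 * m * (q0 + a) * t ^+ 2 <= D / 2.
Proof.
move=> D1 m0 rho0 rho1 q00 q01 r0 r1 LD hA hB a t.
have s0 : 0 < q1 - q0 by rewrite subr_gt0.
have a0 : 0 < a by apply: mulr_gt0.
pose G := r ^+ 2 * m.
have G0 : 0 < G by rewrite mulr_gt0 // exprn_gt0.
have A : 216 * q0 * L <= G * a ^+ 2.
  have c0 : 0 < q0 * (r ^+ 2 * rho ^+ 2 * m) by rewrite !mulr_gt0 // exprn_gt0.
  move: hA; rewrite -(ler_pM2r c0).
  have -> : 216 / (r ^+ 2 * rho ^+ 2 * m) * L * (q0 * (r ^+ 2 * rho ^+ 2 * m)) =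
    216 * q0 * L by field; rewrite !gt_eqF.
  suff -> : (q1 - q0) ^+ 2 / q0 * (q0 * (r ^+ 2 * rho ^+ 2 * m)) = G * a ^+ 2 by [].
  by rewrite /G /a; field; rewrite gt_eqF.
have B : 864 * L <= q1 * rho * G.
  move: hB; rewrite -(ler_pM2r G0).
  suff -> : 864 / (r ^+ 2 * m) * L * G = 864 * L by [].
  by rewrite /G; field; rewrite !gt_eqF.
(* If q0 <= q1 - q0 then q1 <= 2 (q1 - q0) and [B] suffices; otherwise a <= q0 and [A] can be
   divided by a. *)
have C : 216 * L <= G * a.
  have [q0s|sq0] := leP q0 (q1 - q0).
    have : q1 * rho <= 2 * a by rewrite /a; nra.
    by move=> h; nra.
  have aq0 : a <= q0 by rewrite /a; nra.
  rewrite -(ler_pM2r a0); nra.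
have rma0 : 0 < r * m * a by rewrite !mulr_gt0.
have Ga : G * a <= r * m * a.
  by rewrite /G expr2 -!mulrA ler_piMl // !mulr_ge0 // ltW.
split.
  apply/andP; split; first by rewrite divr_ge0 ?ltW //; lra.
  by rewrite ler_pdivrMr //; lra.
have -> : 2 * m * (q0 + a) * t ^+ 2 = 128 * D ^+ 2 * (q0 + a) / (G * a ^+ 2).
  by rewrite /t /G; field; rewrite !gt_eqF.
have Ga2 : 0 < G * a ^+ 2 by rewrite mulr_gt0 // exprn_gt0.
rewrite ler_pdivrMr //.
(* Average of [A] and a times [C]; then 108 * 17/6 = 306 >= 256 gives [F]. *)
have E : 108 * (q0 + a) * L <= G * a ^+ 2.
  have : 216 * L * a <= G * a * a by rewrite ler_pM2r.
  by rewrite expr2 [G * (a * a)]mulrA; lra.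
have F : 256 * D * (q0 + a) <= G * a ^+ 2 by nra.
nra.
Qed.

(** * Assembly of the mean-square bound *)

Theorem mainTheorem13 (R : realType) (n k : nat) (rho q0 q1 r : R) :
  (2 <= n)%N ->
  0 < rho -> rho <= 1 / 2 ->
  0 < q0 -> q0 < q1 -> q1 < 1 ->
  0 < r -> r < 1 ->
  let D : nat := (2 * k + 1)%N in
  let nu : R := Num.min rho (Num.min q0 (1 - q1)) in
  let L : R := ln 4 + 3 * D%:R * ln (9 / nu) in
  (q1 - q0) ^+ 2 / q0 >= 216 / (r ^+ 2 * rho ^+ 2 * (n - 1)%:R) * L ->
  q1 * rho >= 864 / (r ^+ 2 * (n - 1)%:R) * L ->
  pds_mse n k rho q0 q1 <= D%:R ^+ 2 * r ^+ (D - 1).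
Proof.
case: n => [//|[//|n]] _ rho0 rho12 q00 q01 q11 r0 r1 D nu L; rewrite subSS subn0 => hA hB.
have D1 : 1 <= D%:R :> R by rewrite ler1n /D addn1.
have rho1 : rho <= 1 by lra.
have nu0 : 0 < nu by rewrite !lt_min rho0 q00 subr_gt0.
have nu12 : nu <= 1 / 2 by rewrite ge_min rho12.
(* Since nu <= 1/2, 9/nu >= 18, and 3 * 17/18 = 17/6. *)
have LD : 17 / 6 * D%:R <= L.
  have : ln 18 <= ln (9 / nu) by rewrite ler_ln ?posrE ?divr_gt0 // ler_pdivlMr //; lra.
  have : 0 <= ln 4 :> R by rewrite ln_ge0 // ler1n.
  have := ln18_ge R; rewrite /L; nra.
have m0 : 0 < n.+1%:R :> R by rewrite ltr0n.
have [/andP[t0 t12] tD] := snr_bounds R _ _ _ _ _ _ _ D1 m0 rho0 rho1 q00 q01 r0 (ltW r1) LD hA hB.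
set a := (q1 - q0) * rho in t0 t12 tD; set t := 8 * D%:R / _ in t0 t12 tD.
have a0 : 0 < a by rewrite mulr_gt0 ?subr_gt0.
pose W (v : {ffun 'I_n.+2 -> bool}) (Y : {ffun Pairs n.+2 -> bool}) : R :=
  \sum_(e : Pairs n.+2 | nat_of_ord (val e).1 == 0%N) (Y e)%:R -
  n.+1%:R * (q0 + a * (v ord0)%:R).
pose K : R := D%:R ^+ 2 * r ^+ (2 * k) / (4 ^+ k * 16).
have K0 : 0 <= K by rewrite divr_ge0 ?mulr_ge0 ?exprn_ge0 ?ler0n // ltW.
have target (v : {ffun 'I_n.+2 -> bool}) : pds_target R v = (v ord0)%:R.
  congr (_%:R); congr nat_of_bool; apply/existsP/idP => [[i /andP[/eqP i0]]|v0].
    by have -> : i = ord0 by apply: val_inj.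
  by exists ord0.
(* The absolute value in the exponent is removed by e^|y| <= e^y + e^(-y); t is scaled so that t W =
   (8D/r)(z - x). *)
have pointwise v Y : (pds_f k rho q0 q1 Y - pds_target R v) ^+ 2 <=
    K * (expR (t * W v Y) + expR (- t * W v Y)).
  rewrite target; apply: le_trans (tau_error_le_exp R k _ _ r r0 (ltW r1)) _.
  apply: ler_wpM2l => //; set z := a^-1 * _.
  have -> : 8 * (2 * k + 1)%:R / r * `|z - (v ord0)%:R| = `|t * W v Y|.
    have -> : t * W v Y = 8 * D%:R / r * (z - (v ord0)%:R).
      rewrite /z /row_mean subSS subn0 /t /W -/a; field.
      by rewrite nat1r !gt_eqF.
    by rewrite [RHS]normrM ger0_norm // divr_ge0 ?mulr_ge0 ?ler0n // ltW.
  rewrite mulNr; have [_|_] := ger0P (t * W v Y).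
    by rewrite lerDl expR_ge0.
  by rewrite lerDr expR_ge0.
have moment s : s <= 1 / 2 -> s ^+ 2 = t ^+ 2 ->
    \sum_v \sum_Y pds_weight rho q0 q1 v Y * expR (s * W v Y) <= 2 ^+ D.
  move=> s12 st.
  apply: le_trans (first_row_exp_moment R n rho q0 q1 s (ltW rho0) rho1
    (ltW q00) (ltW q01) (ltW q11) s12) _.
  rewrite -/a st; apply: (@le_trans _ _ (expR (D%:R * (1 / 2)))).
    by rewrite ler_expR; lra.
  (* It remains that e^(1/2) <= 2, which follows from e^(-1/2) >= 1 - 1/2. *)
  rewrite expRM_natl lerXn2r ?nnegrE ?expR_ge0 //.
  have := expR_ge1Dx (- (1 / 2) : R); rewrite expRN => h.
  have e0 := expR_gt0 (1 / 2 : R).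
  have : (1 / 2) * expR (1 / 2) <= 1 :> R by rewrite -ler_pdivlMr //; lra.
  lra.
have -> : (D - 1)%N = (2 * k)%N by rewrite /D addnK.
apply: (@le_trans _ _ (K * (2 ^+ D + 2 ^+ D))).
  apply: (@le_trans _ _ (K * (
    \sum_v \sum_Y pds_weight rho q0 q1 v Y * expR (t * W v Y) +
    \sum_v \sum_Y pds_weight rho q0 q1 v Y * expR (- t * W v Y)))).
    rewrite -big_split mulr_sumr /=; apply: ler_sum => v _.
    rewrite -big_split mulr_sumr /=; apply: ler_sum => Y _.
    rewrite -mulrDr [X in _ <= X]mulrCA; apply: ler_wpM2l; last exact: pointwise.
    by apply: pds_weight_ge0 => //; apply: ltW.
  apply: ler_wpM2l => //; apply: lerD; apply: moment => //; first by lra.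
  by rewrite sqrrN.
(* The two moments total 4 * 4^k, which cancels 4^k in [K] and leaves a spare factor 1/4. *)
have -> : K * (2 ^+ D + 2 ^+ D) = D%:R ^+ 2 * r ^+ (2 * k) / 4.
  have e4 : 2 ^+ (2 * k) = 4 ^+ k :> R by rewrite exprM; congr (_ ^+ _); ring.
  rewrite /K /D exprD expr1 e4; field.
  by rewrite expf_neq0 // pnatr_eq0.
rewrite ler_pdivrMr ?ltr0n // ler_peMr ?ler1n //.
by rewrite mulr_ge0 ?exprn_ge0 // ltW.
Qed.
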